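(* Let $p$ be a prime and $e$ a positive integer. The map $$\Psi : (\operatorname{Aut}(\mathbb{Z}/p^e\mathbb{Z},\cdot),\circ) \to (U_{p^{e-1}} \rtimes \mathcal{A}_{p^e}, \star), \qquad \psi_{r,\phi} \mapsto ([r]_{p^{e-1}}, \phi)$$ (where $r\in\mathbb{Z}$ with $\gcd(r,p)=1$ and $\phi\in\mathcal{A}_{p^e}$) is a group isomorphism.
   Context: For integers $a$ and $n\ge 1$, $[a]_n$ is the class of $a$ modulo $n$, and $[a]$ means $[a]_{p^e}$. $U_{n}$ is the multiplicative group of invertible classes modulo $n$ (so $U_{1}=U_{p^0}$ is the trivial group). $\operatorname{Aut}(\mathbb{Z}/p^e\mathbb{Z},\cdot)$ is the group of automorphisms of the multiplicative monoid $(\mathbb{Z}/p^e\mathbb{Z},\cdot,[1])$, and $\operatorname{Aut}(U_{p^e},\cdot)$ is the automorphism group of the group $U_{p^e}$. Convention: $s^0=[1]$ for all $s\in\mathbb{Z}/p^e\mathbb{Z}$, including $s=[0]$. $\mathcal{A}_{p^e}$ is the subgroup of $\operatorname{Aut}(U_{p^e},\cdot)$ consisting of those $\phi$ that induce an automorphism of $U_{p^f}$ for every integer $0\le f\le e$; that is, for all integers $r,r',s,s',f$ with $\gcd(r,p)=\gcd(r',p)=1$, $\phi([r])=[s]$, $\phi([r'])=[s']$ and $0\le f\le e$, one has $[r]_{p^f}=[r']_{p^f}$ if and only if $[s]_{p^f}=[s']_{p^f}$. For $\phi\in\mathcal{A}_{p^e}$ and $0\le f\le e$, $\phi_f$ denotes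 the induced automorphism of $U_{p^f}$: $\phi_f([r]_{p^f})=[s]_{p^f}$ where $\phi([r])=[s]$. For $r\in\mathbb{Z}$ with $\gcd(r,p)=1$ and $\phi\in\mathcal{A}_{p^e}$, $\psi_{r,\phi}$ is the automorphism of $(\mathbb{Z}/p^e\mathbb{Z},\cdot)$ given by $\psi_{r,\phi}([p]^u b)=[pr]^u\phi(b)$ for $u\in\{0,1,\dots,e\}$, $b\in U_{p^e}$; every automorphism of $(\mathbb{Z}/p^e\mathbb{Z},\cdot)$ is of this form. $(U_{p^{e-1}}\rtimes\mathcal{A}_{p^e},\star)$ is the group with underlying set $U_{p^{e-1}}\times\mathcal{A}_{p^e}$ and operation $([r]_{p^{e-1}},\phi)\star([r']_{p^{e-1}},\phi')=([r]_{p^{e-1}}\,\phi_{e-1}([r']_{p^{e-1}}),\ \phi\circ\phi')$. *)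

(* Defs.v *)
From HB Require Import structures.
From mathcomp Require Import all_boot all_order all_algebra all_fingroup.

Set Implicit Arguments.
Unset Strict Implicit.
Unset Printing Implicit Defensive.

Import Order.TTheory GRing.Theory Num.Theory.
Local Open Scope ring_scope.

(* [a]_n as an element of U_n, for a coprime to n (1 otherwise).  The ring
   'Z_1 is Z/2Z, not the zero ring, but {unit 'Z_1} is trivial all the same, so
   {unit 'Z_n} is U_n for every n >= 1, and ucl 1 a is the unique element of
   U_1 for every a. *)
Definition ucl (n : nat) (a : int) : {unit 'Z_n} :=
  insubd (1%g : {unit 'Z_n}) (a%:~R : 'Z_n).

(* [r]_n |-> [r]_m, via the representative of [r]_n in {0, ..., n - 1}. *)
Definition ured (n m : nat) (x : {unit 'Z_n}) : {unit 'Z_m} :=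
  ucl m (nat_of_ord (val x))%:Z.

Lemma unitZ1_triv n (x y : {unit 'Z_n}) : (n <= 1)%N -> x = y.
Proof.
have unit_lt2 (k : 'I_2) : k \is a GRing.unit -> k = 1.
  by case: k => [[|[|k]] lk] // _; apply: val_inj.
by case: n x y => [|[|n]] // [x Ux] [y Uy] _; apply: val_inj => /=;
  rewrite (unit_lt2 _ Ux) (unit_lt2 _ Uy).
Qed.

Lemma coprime_uval n (x : {unit 'Z_n}) :
  (1 < n)%N -> coprime n (nat_of_ord (val x)).
Proof. by move=> n1; rewrite -unitZpE // natr_Zp; exact: valP x. Qed.

Lemma eq_natZ n (a b : nat) : (1 < n)%N ->
  (a%:R == b%:R :> 'Z_n) = (a == b %[mod n]).
Proof. by move=> n1; rewrite -val_eqE /= !val_Zp_nat. Qed.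

Lemma val_ucl_nat n (a : nat) : (1 < n)%N -> coprime n a ->
  val (ucl n a) = a%:R :> 'Z_n.
Proof. by move=> n1 ca; rewrite val_insubd /= unitZpE // ca. Qed.

Lemma intZE n (a : int) : (1 < n)%N ->
  a%:~R = `|(a %% n%:Z)%Z|%:R :> 'Z_n.
Proof.
move=> n1; rewrite {1}(divz_eq a n) rmorphD rmorphM /=.
have -> : (n%:Z)%:~R = 0 :> 'Z_n.
  by apply/eqP; rewrite (eq_natZ n 0) // modnn mod0n.
rewrite mulr0 add0r -[in LHS](@gez0_abs (a %% n)%Z) // modz_ge0 //.
by case: n n1.
Qed.

Lemma coprime_absmod n (a : int) : (1 < n)%N -> coprimez n a ->
  coprime n `|(a %% n%:Z)%Z|.
Proof.
move=> n1 ca; rewrite -[coprime _ _]/(coprimez n%:Z `|(a %% n)%Z|%:Z).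
rewrite gez0_abs; first by rewrite /coprimez gcdz_modr.
by rewrite modz_ge0 //; case: n n1 {ca}.
Qed.

Lemma val_ucl n (a : int) : (1 < n)%N -> coprimez n a ->
  val (ucl n a) = a%:~R :> 'Z_n.
Proof.
by move=> n1 ca; rewrite val_insubd /= intZE // unitZpE // coprime_absmod.
Qed.

Lemma ucl_eqP n (a b : int) : (0 < n)%N -> coprimez n a -> coprimez n b ->
  reflect (a = b %[mod n%:Z])%Z (ucl n a == ucl n b).
Proof.
case: n => [|[|n]] // _ ca cb.
  by rewrite (unitZ1_triv (ucl 1 a) (ucl 1 b)) // eqxx; apply: ReflectT; rewrite !modz1.
rewrite -val_eqE /= !val_ucl // !intZE // eq_natZ //.
have h (c : int) : (`|(c %% n.+2)%Z| < n.+2)%N.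
  by rewrite -ltz_nat gez0_abs ?modz_ge0 // ltz_pmod.
rewrite !modn_small //.
apply: (iffP eqP) => [|-> //] E.
rewrite -[LHS]gez0_abs ?modz_ge0 // E gez0_abs ?modz_ge0 //.
Qed.

Lemma ucl_nat_eq n (a b : nat) : (0 < n)%N -> coprime n a -> coprime n b ->
  (ucl n a == ucl n b) = (a == b %[mod n]).
Proof.
move=> n0 ca cb; have E := @ucl_eqP n a b n0 ca cb.
apply/idP/idP => [/E | /eqP ab].
  by rewrite !modz_nat => -[->].
by apply/E; rewrite !modz_nat ab.
Qed.

Section MonoidAut.
Variable n : nat.

Definition monaut_axiom (s : {perm 'Z_n}) : bool :=
  (s 1 == 1) && [forall x, forall y, s (x * y) == s x * s y].

Record monaut : predArgType :=
  Monaut { monaut_perm :> {perm 'Z_n}; _ : monaut_axiom monaut_perm }.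

HB.instance Definition _ := [isSub for monaut_perm].
HB.instance Definition _ := [Finite of monaut by <:].

Lemma monaut1 (g : monaut) : g 1 = 1.
Proof. by case: g => s /= /andP[/eqP]. Qed.

Lemma monautM (g : monaut) : {morph g : x y / x * y}.
Proof. by case: g => s /= /andP[_ /'forall_'forall_eqP]. Qed.

Lemma monaut_axiomP (s : {perm 'Z_n}) :
  s 1 = 1 -> {morph s : x y / x * y} -> monaut_axiom s.
Proof.
by move=> s1 sM; rewrite /monaut_axiom s1 eqxx; apply/'forall_'forall_eqP.
Qed.

Lemma monaut_id_proof : monaut_axiom 1%g.
Proof. by apply: monaut_axiomP => [|x y]; rewrite !perm1. Qed.

Lemma monaut_comp_proof (g h : monaut) :
  monaut_axiom (monaut_perm h * monaut_perm g)%g.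
Proof.
by apply: monaut_axiomP => [|x y]; rewrite !permM ?monaut1 // !monautM.
Qed.

Lemma monaut_inv_proof (g : monaut) : monaut_axiom (monaut_perm g)^-1%g.
Proof.
apply: monaut_axiomP => [|x y]; apply: (@perm_inj _ g).
  by rewrite permKV monaut1.
by rewrite monautM !permKV.
Qed.

(* In {perm T}, s * t is t \o s; the group law here is g * h = g \o h. *)
Definition monaut_id := Monaut monaut_id_proof.
Definition monaut_comp g h := Monaut (monaut_comp_proof g h).
Definition monaut_inv g := Monaut (monaut_inv_proof g).

Lemma monaut_compA : associative monaut_comp.
Proof. by move=> f g h; apply: val_inj; rewrite /= mulgA. Qed.
Lemma monaut_comp1 : left_id monaut_id monaut_comp.
Proof. by move=> f; apply: val_inj; rewrite /= mulg1. Qed.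
Lemma monaut_compV : left_inverse monaut_id monaut_inv monaut_comp.
Proof. by move=> f; apply: val_inj; rewrite /= mulgV. Qed.

HB.instance Definition _ :=
  Finite_isGroup.Build monaut monaut_compA monaut_comp1 monaut_compV.

Lemma monautE (g h : monaut) x : (g * h)%g x = g (h x).
Proof. by rewrite permM. Qed.

End MonoidAut.

Section Reduction.
Variables p e f : nat.
Hypothesis fe : (f <= e)%N.

Lemma pexp_gt1 : (1 < p ^ f)%N -> [/\ (1 < p)%N, (0 < f)%N & (1 < p ^ e)%N].
Proof.
case: f fe => [|k] // ke; have e0 : (0 < e)%N by apply: leq_trans ke.
case: p => [|[|q]]; rewrite ?exp0n ?exp1n // => _.
by split=> //; apply: leq_trans (ltn_expl e _).
Qed.

Lemma coprime_pexpS (a : nat) : (0 < f)%N ->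
  coprime (p ^ e) a = coprime (p ^ f) a.
Proof. by move=> f0; have e0 := leq_trans f0 fe; rewrite !coprime_pexpl. Qed.

Lemma uredK (y : {unit 'Z_(p ^ f)}) : ured (p ^ f) (ured (p ^ e) y) = y.
Proof.
have [|n1] := leqP (p ^ f) 1; first exact: unitZ1_triv.
have [p1 f0 m1] := pexp_gt1 n1.
have cy := coprime_uval y n1.
have cy' : coprime (p ^ e) (val y) by rewrite coprime_pexpS.
have rE : val (ured (p ^ e) y) = (nat_of_ord (val y))%:R by rewrite val_ucl_nat.
have cr : coprime (p ^ f) (val (ured (p ^ e) y)).
  by rewrite -coprime_pexpS // coprime_uval.
apply: val_inj; rewrite val_ucl_nat // rE -[RHS]natr_Zp; apply/eqP.
by rewrite eq_natZ // val_Zp_nat // modn_dvdm // dvdn_exp2l.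
Qed.

Lemma val_ured (x : {unit 'Z_(p ^ e)}) : (1 < p ^ f)%N ->
  val (ured (p ^ f) x) = (nat_of_ord (val x))%:R.
Proof.
move=> n1; have [p1 f0 m1] := pexp_gt1 n1.
by rewrite /ured val_ucl_nat // -coprime_pexpS // coprime_uval.
Qed.

Lemma uredM :
  {morph (ured (p ^ f) : {unit 'Z_(p ^ e)} -> _) : x y / (x * y)%g}.
Proof.
move=> x y; have [|n1] := leqP (p ^ f) 1; first exact: unitZ1_triv.
have [p1 f0 m1] := pexp_gt1 n1.
apply: val_inj; rewrite FinRing.val_unitM !val_ured // FinRing.val_unitM.
rewrite -[in LHS](natr_Zp (val x)) -[in LHS](natr_Zp (val y)) -!natrM.
by apply/eqP; rewrite eq_natZ // val_Zp_nat // modn_dvdm ?dvdn_exp2l.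
Qed.

Lemma ured_eq (x y : {unit 'Z_(p ^ e)}) : (0 < p)%N ->
  (ured (p ^ f) x == ured (p ^ f) y) = (val x == val y %[mod p ^ f]).
Proof.
move=> p0; have [n1|n1] := leqP (p ^ f) 1.
  have /eqP -> : (p ^ f)%N == 1%N by rewrite eqn_leq n1 expn_gt0 p0.
  by rewrite !modn1 eqxx; apply/eqP/unitZ1_triv.
have [p1 f0 m1] := pexp_gt1 n1.
by rewrite -val_eqE /= !val_ured // eq_natZ.
Qed.

Lemma ured_ucl (a : int) : prime p -> coprimez p a ->
  ured (p ^ f) (ucl (p ^ e) a) = ucl (p ^ f) a.
Proof.
move=> pp ca; have [|n1] := leqP (p ^ f) 1; first exact: unitZ1_triv.
have [p1 f0 m1] := pexp_gt1 n1.
have cpk k : coprimez (p ^ k)%N%:Z a by rewrite coprimezE /= coprimeXl.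
apply: val_inj; rewrite val_ured // !val_ucl // !intZE // val_Zp_nat //.
apply/eqP; rewrite eq_natZ // modn_dvdm ?dvdn_exp2l //.
set m := (p ^ e)%N; set n := (p ^ f)%N.
have n0 : n%:Z != 0 by rewrite -lt0n ltnW.
have m0 : m%:Z != 0 by rewrite -lt0n ltnW.
have nm : (n%:Z %| m%:Z)%Z by rewrite dvdzE /= dvdn_exp2l.
rewrite -eqz_nat -!modz_nat !gez0_abs ?modz_ge0 // modz_mod.
have /dvdzP[q mE] := nm.
have {2}-> : a = (a %/ m)%Z * q * n + (a %% m)%Z by rewrite -mulrA -mE -divz_eq.
by rewrite modzMDl.
Qed.

End Reduction.

Section CA.
Variables p e : nat.
Local Notation U f := {unit 'Z_(p ^ f)}.

(* The quantification over integers r, r' prime to p is replaced by one over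
   x = [r], y = [r'] in U_(p^e); see cA_axiomP for the integer form. *)
Definition cA_axiom (s : {perm U e}) : bool :=
  (s \in Aut (units_Zp (p ^ e))) &&
  [forall f : 'I_e.+1, forall x : U e, forall y : U e,
    (ured (p ^ f) x == ured (p ^ f) y) ==
    (ured (p ^ f) (s x) == ured (p ^ f) (s y))].

Record cA : predArgType :=
  CA { cA_perm :> {perm U e}; _ : cA_axiom cA_perm }.

HB.instance Definition _ := [isSub for cA_perm].
HB.instance Definition _ := [Finite of cA by <:].

Lemma cA_Aut (phi : cA) : cA_perm phi \in Aut (units_Zp (p ^ e)).
Proof. by case: phi => s /= /andP[]. Qed.

Lemma cAM (phi : cA) : {morph phi : x y / (x * y)%g}.
Proof.
by move=> x y; apply: (morphicP (Aut_morphic (cA_Aut phi))); rewrite inE.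
Qed.

Lemma cA_ured (phi : cA) f x y : (f <= e)%N ->
  (ured (p ^ f) (phi x) == ured (p ^ f) (phi y)) =
  (ured (p ^ f) x == ured (p ^ f) y).
Proof.
case: phi => s /= /andP[_ /forallP h] fe.
have lf : (f < e.+1)%N by [].
have /forallP/(_ x)/forallP/(_ y)/eqP/esym H := h (Ordinal lf).
exact: H.
Qed.

Lemma cA_axiomI (s : {perm U e}) : s \in Aut (units_Zp (p ^ e)) ->
  (forall f x y, (f <= e)%N ->
     (ured (p ^ f) (s x) == ured (p ^ f) (s y)) =
     (ured (p ^ f) x == ured (p ^ f) y)) ->
  cA_axiom s.
Proof.
move=> sA h; apply/andP; split=> //.
apply/forallP => f; apply/forallP => x; apply/forallP => y.
by rewrite h // -ltnS ltn_ord.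
Qed.

Lemma cA_id_proof : cA_axiom 1%g.
Proof. by apply: cA_axiomI => [|f x y _]; rewrite ?group1 ?perm1. Qed.

Lemma cA_comp_proof (g h : cA) : cA_axiom (cA_perm h * cA_perm g)%g.
Proof.
apply: cA_axiomI => [|f x y fe]; first by rewrite groupM ?cA_Aut.
by rewrite !permM !cA_ured.
Qed.

Lemma cA_inv_proof (g : cA) : cA_axiom (cA_perm g)^-1%g.
Proof.
apply: cA_axiomI => [|f x y fe]; first by rewrite groupV cA_Aut.
by rewrite -(cA_ured g) // !permKV.
Qed.

(* As for monaut, the group law is composition: phi * phi' = phi \o phi'. *)
Definition cA_id := CA cA_id_proof.
Definition cA_comp g h := CA (cA_comp_proof g h).
Definition cA_inv g := CA (cA_inv_proof g).

Lemma cA_compA : associative cA_comp.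
Proof. by move=> f g h; apply: val_inj; rewrite /= mulgA. Qed.
Lemma cA_comp1 : left_id cA_id cA_comp.
Proof. by move=> f; apply: val_inj; rewrite /= mulg1. Qed.
Lemma cA_compV : left_inverse cA_id cA_inv cA_comp.
Proof. by move=> f; apply: val_inj; rewrite /= mulgV. Qed.

HB.instance Definition _ :=
  Finite_isGroup.Build cA cA_compA cA_comp1 cA_compV.

Lemma cAE (g h : cA) x : (g * h)%g x = g (h x).
Proof. by rewrite permM. Qed.

(* The induced automorphism phi_f of U_(p^f), computed by lifting y to U_(p^e);
   it does not depend on the lift when f <= e (cA_redE). *)
Definition cA_red (phi : cA) (f : nat) (y : U f) : U f :=
  ured (p ^ f) (phi (ured (p ^ e) y)).

Lemma cA_redE phi f (x : U e) : (f <= e)%N ->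
  cA_red phi (ured (p ^ f) x) = ured (p ^ f) (phi x).
Proof. by move=> fe; apply/eqP; rewrite cA_ured // uredK. Qed.

Lemma cA_redM phi f : (f <= e)%N ->
  {morph @cA_red phi f : x y / (x * y)%g}.
Proof.
move=> fe x y; rewrite -(uredK fe x) -(uredK fe y) -uredM // !cA_redE //.
by rewrite cAM uredM.
Qed.

Lemma cA_red_comp phi phi' f (y : U f) : (f <= e)%N ->
  cA_red (phi * phi')%g y = cA_red phi (cA_red phi' y).
Proof. by move=> fe; rewrite -(uredK fe y) !cA_redE // cAE. Qed.

Lemma cA_red_id f (y : U f) : (f <= e)%N -> cA_red 1%g y = y.
Proof. by move=> fe; rewrite -{1}(uredK fe y) cA_redE // perm1 uredK. Qed.

(* Underlying set of the semidirect product; its law is sd_star. *)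
Definition sdUA : predArgType := (U e.-1 * cA)%type.

HB.instance Definition _ := Finite.on sdUA.

Definition sd_star (x y : sdUA) : sdUA :=
  ((x.1 * cA_red x.2 y.1)%g, (x.2 * y.2)%g).
Definition sd_id : sdUA := (1%g, 1%g).
Definition sd_inv (x : sdUA) : sdUA := (cA_red x.2^-1 x.1^-1, x.2^-1)%g.

Lemma sd_starA : associative sd_star.
Proof.
move=> x y z; rewrite /sd_star /= cA_redM ?leq_pred // cA_red_comp ?leq_pred //.
by rewrite !mulgA.
Qed.
Lemma sd_star1 : left_id sd_id sd_star.
Proof.
by case=> a phi; rewrite /sd_star /= cA_red_id ?leq_pred // !mul1g.
Qed.
Lemma sd_starV : left_inverse sd_id sd_inv sd_star.
Proof.
case=> a phi; rewrite /sd_star /= -cA_redM ?leq_pred // !mulVg.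
congr (_, _); have := @cA_redM phi^-1%g e.-1 (leq_pred e) 1%g 1%g.
by rewrite mulg1 => /(congr1 (mulg (cA_red phi^-1 1)^-1)%g); rewrite mulKg mulVg.
Qed.

HB.instance Definition _ :=
  Finite_isGroup.Build sdUA sd_starA sd_star1 sd_starV.

End CA.

Section Psi.
Variables p e : nat.
Hypotheses (p_pr : prime p) (e_gt0 : (0 < e)%N).
Local Notation R := 'Z_(p ^ e).
Local Notation U f := {unit 'Z_(p ^ f)}.

Let pe_gt1 : (1 < p ^ e)%N.
Proof. exact: leq_ltn_trans e_gt0 (ltn_expl e (prime_gt1 p_pr)). Qed.

Lemma coprimez_pexp f (a : int) : coprimez p a -> coprimez (p ^ f)%N a.
Proof. by move=> ca; rewrite coprimezE /= coprimeXl. Qed.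

Lemma coprime_pu (x : U e) : coprime p (val x).
Proof. by rewrite -(coprime_pexpl _ _ e_gt0) coprime_uval. Qed.

Lemma ucl_surj (x : U e) : ucl (p ^ e) (nat_of_ord (val x))%:Z = x.
Proof.
by apply: val_inj; rewrite val_ucl_nat ?natr_Zp ?coprime_uval.
Qed.

Lemma ured_ucl_eqP f (a b : int) : (f <= e)%N -> coprimez p a -> coprimez p b ->
  reflect (a = b %[mod (p ^ f)%N])%Z
    (ured (p ^ f) (ucl (p ^ e) a) == ured (p ^ f) (ucl (p ^ e) b)).
Proof.
move=> fe ca cb; rewrite !ured_ucl //.
by apply: ucl_eqP; rewrite ?expn_gt0 ?prime_gt0 // coprimez_pexp.
Qed.

Lemma cA_axiomP (s : {perm U e}) : s \in Aut (units_Zp (p ^ e)) ->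
  reflect
    (forall (r r' t t' : int) (f : nat), (f <= e)%N ->
      coprimez p r -> coprimez p r' -> coprimez p t -> coprimez p t' ->
      s (ucl (p ^ e) r) = ucl (p ^ e) t ->
      s (ucl (p ^ e) r') = ucl (p ^ e) t' ->
      (r = r' %[mod (p ^ f)%N])%Z <-> (t = t' %[mod (p ^ f)%N])%Z)
    (cA_axiom s).
Proof.
move=> sA; apply: (iffP idP) => [sC r r' t t' f fe cr cr' ct ct' E E' | h].
  have := cA_ured (CA sC) (ucl _ r) (ucl _ r') fe; rewrite /= E E' => EE.
  split=> [/(ured_ucl_eqP fe cr cr') | /(ured_ucl_eqP fe ct ct')].
    by rewrite -EE => /(ured_ucl_eqP fe ct ct').
  by rewrite EE => /(ured_ucl_eqP fe cr cr').
apply: cA_axiomI => // f x y fe.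
have cp (z : U e) : coprimez p (nat_of_ord (val z))%:Z by exact: coprime_pu.
have := h _ _ _ _ f fe (cp x) (cp y) (cp (s x)) (cp (s y)).
rewrite !ucl_surj => /(_ erefl erefl) H.
rewrite -(ucl_surj (s x)) -(ucl_surj (s y)).
rewrite -{2}(ucl_surj x) -{2}(ucl_surj y).
by apply/(ured_ucl_eqP fe (cp _) (cp _))/(ured_ucl_eqP fe (cp _) (cp _)); apply H.
Qed.

Lemma cA_red_ucl (phi : cA p e) f (r t : int) : (f <= e)%N ->
  coprimez p r -> coprimez p t -> phi (ucl (p ^ e) r) = ucl (p ^ e) t ->
  cA_red phi (ucl (p ^ f) r) = ucl (p ^ f) t.
Proof.
by move=> fe cr ct E; rewrite -(ured_ucl fe) // cA_redE // E ured_ucl.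
Qed.

Lemma pXe_eq0 w : (e <= w)%N -> p%:R ^+ w = 0 :> R.
Proof.
move=> ew; rewrite -natrX; apply/eqP.
by rewrite (eq_natZ _ 0) // mod0n -/(dvdn _ _) dvdn_exp2l.
Qed.

Lemma pXu_decomp (x : R) :
  exists ub : 'I_e.+1 * U e, x == p%:R ^+ ub.1 * val ub.2.
Proof.
have [->|x0] := eqVneq x 0.
  by exists (ord_max, 1%g); rewrite /= pXe_eq0 // mul0r.
have n0 : (0 < nat_of_ord x)%N by rewrite lt0n; apply: contra x0 => /eqP E; apply/eqP/val_inj.
have [k ck kE] := pfactor_coprime p_pr n0.
have xl : (nat_of_ord x < p ^ e)%N by rewrite -[X in (_ < X)%N](Zp_cast pe_gt1).
have le : (logn p x < e.+1)%N.
  rewrite ltnS -(leq_exp2l _ _ (prime_gt1 p_pr)); apply: leq_trans (ltnW xl).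
  by rewrite {2}kE leq_pmull //; case: k ck kE n0 => // _ ->.
exists (Ordinal le, ucl (p ^ e) k); rewrite /= val_ucl_nat ?coprimeXl //.
by rewrite -natrX -natrM mulnC -kE natr_Zp.
Qed.

Lemma pXu_eq u v (b c : U e) : (u <= e)%N -> (v <= e)%N ->
  (p%:R ^+ u * val b == p%:R ^+ v * val c) =
  (u == v) && (ured (p ^ (e - u)) b == ured (p ^ (e - u)) c).
Proof.
have p0 := prime_gt0 p_pr.
have key w z (d a : U e) : (w < z <= e)%N ->
    p%:R ^+ w * val d == p%:R ^+ z * val a -> false.
  case/andP=> wz ze; rewrite -(natr_Zp (val d)) -(natr_Zp (val a)) -!natrX -!natrM eq_natZ //.
  move=> /eqP E.
  have : (p ^ w.+1 %| p ^ w * val d)%N.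
    have pz : (p ^ w.+1 %| p ^ e)%N by rewrite dvdn_exp2l // (leq_trans wz).
    rewrite /dvdn -(modn_dvdm _ pz) E (modn_dvdm _ pz).
    by rewrite -/(dvdn _ _) dvdn_mulr // dvdn_exp2l.
  rewrite expnSr dvdn_pmul2l ?expn_gt0 ?p0 // => pd.
  by have := coprime_pu d; rewrite prime_coprime // pd.
move=> ue ve; case: (ltngtP u v) => [uv|vu|<-]; rewrite ?andbF ?andTb.
- by apply/negbTE/negP => /key; rewrite uv ve => /(_ isT).
- by apply/negbTE/negP; rewrite eq_sym => /key; rewrite vu ue => /(_ isT).
rewrite ured_eq ?leq_subr //.
rewrite -[in LHS](natr_Zp (val b)) -[in LHS](natr_Zp (val c)).
rewrite -!natrX -!natrM eq_natZ //.
move: (nat_of_ord _) (nat_of_ord _) => {}b {}c.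
have -> : (p ^ e = p ^ u * p ^ (e - u))%N by rewrite -expnD subnKC.
by rewrite -!muln_modr eqn_pmul2l ?expn_gt0 ?p0.
Qed.

Section Def.
Variables (r : int) (r_cop : coprimez p r) (phi : cA p e).

(* [p]^u b |-> [p r]^u phi(b), evaluated at some decomposition of x; psiE below
   shows that every decomposition gives the same value. *)
Definition psi_fun (x : R) : R :=
  if [pick ub : 'I_e.+1 * U e | x == p%:R ^+ ub.1 * val ub.2] is Some (u, b)
  then (p%:Z * r)%:~R ^+ u * val (phi b) else x.

Let psi_valE u (b : U e) : (p%:Z * r)%:~R ^+ u * val (phi b) =
  p%:R ^+ u * val (ucl (p ^ e) r ^+ u * phi b)%g.
Proof.
rewrite FinRing.val_unitM FinRing.val_unitX val_ucl ?coprimez_pexp // mulrA.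
by rewrite -exprMn_comm ?rmorphM //; apply: mulrC.
Qed.

Let psi_eq u v (b c : U e) : (u <= e)%N -> (v <= e)%N ->
  ((p%:Z * r)%:~R ^+ u * val (phi b) == (p%:Z * r)%:~R ^+ v * val (phi c)) =
  (p%:R ^+ u * val b == p%:R ^+ v * val c).
Proof.
move=> ue ve; rewrite !psi_valE !pXu_eq //; case: eqP => //= <-.
rewrite !uredM ?leq_subr // (inj_eq (mulgI _)).
by rewrite cA_ured ?leq_subr.
Qed.

Lemma psi_funE u (b : U e) : (u <= e)%N ->
  psi_fun (p%:R ^+ u * val b) = (p%:Z * r)%:~R ^+ u * val (phi b).
Proof.
move=> ue; rewrite /psi_fun; case: pickP => [[v c] /= E | none].
  by apply/eqP; rewrite eq_sym psi_eq // -ltnS.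
by have := none (inord u, b); rewrite /= inordK ?ltnS // eqxx.
Qed.

Lemma psi_fun_inj : injective psi_fun.
Proof.
move=> x y; have [[u b] /= /eqP ->] := pXu_decomp x.
have [[v c] /= /eqP ->] := pXu_decomp y.
have ue : (u <= e)%N by rewrite -ltnS.
have ve : (v <= e)%N by rewrite -ltnS.
by move=> /eqP; rewrite !psi_funE // psi_eq // => /eqP.
Qed.

Lemma psi_fun_monaut : monaut_axiom (perm psi_fun_inj).
Proof.
apply: monaut_axiomP => [|x y]; rewrite !permE.
  have := @psi_funE 0 1%g (leq0n _); rewrite !expr0 !mul1r /= => ->.
  suff -> : phi 1%g = 1%g by [].
  apply: (mulgI (phi 1%g)).
  by rewrite -cAM !mulg1.
have [[u b] /= /eqP ->] := pXu_decomp x.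
have [[v c] /= /eqP ->] := pXu_decomp y.
have ue : (u <= e)%N by rewrite -ltnS.
have ve : (v <= e)%N by rewrite -ltnS.
rewrite mulrACA -exprD !psi_funE // mulrACA -exprD.
rewrite -!FinRing.val_unitM -cAM.
have [uve|/ltnW uve] := leqP (u + v) e; first by rewrite psi_funE.
rewrite psi_valE !pXe_eq0 // !mul0r.
have := @psi_funE e 1%g (leqnn _); rewrite pXe_eq0 // mul0r => ->.
by rewrite psi_valE pXe_eq0 // mul0r.
Qed.

Definition psi : monaut (p ^ e) := Monaut psi_fun_monaut.

Lemma psiE u (b : U e) : (u <= e)%N ->
  psi (p%:R ^+ u * val b) = (p%:Z * r)%:~R ^+ u * val (phi b).
Proof. by move=> ue; rewrite permE psi_funE. Qed.

End Def.
End Psi.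

(* Main.v *)
(** An automorphism [g] of the monoid Z/p^e permutes the units, and it maps [p]
    to [p] times a unit [c], because [p] is nilpotent of index exactly [e]:
    hence [g = psi_{c, phi}] where [phi] is the restriction of [g] to the units.
    Since [p^u b = p^u b'] exactly when [b] and [b'] agree modulo [p^(e-u)],
    injectivity of [g] says that [phi] lies in A_(p^e); likewise [p r], and with
    it [psi_{r, phi}], depends on [r] only modulo [p^(e-1)], and determines it. *)
Require Import Defs.
From mathcomp Require Import all_boot all_order all_algebra all_fingroup.

Set Implicit Arguments.
Unset Strict Implicit.
Unset Printing Implicit Defensive.

Import GRing.Theory.
Local Open Scope ring_scope.

Section AutomorphismsOfZpe.
Variables (p e : nat) (p_pr : prime p) (e_gt0 : (0 < e)%N).
Local Notation R := 'Z_(p ^ e).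
Local Notation U f := {unit 'Z_(p ^ f)}.

Lemma pexpe_gt1 : (1 < p ^ e)%N.
Proof. exact: leq_ltn_trans e_gt0 (ltn_expl e (prime_gt1 p_pr)). Qed.

Lemma coprimez_pu (x : U e) : coprimez p (nat_of_ord (val x))%:Z.
Proof. exact: coprime_pu. Qed.

Lemma pr_ucl (r : int) : coprimez p r ->
  (p%:Z * r)%:~R = p%:R * val (ucl (p ^ e) r) :> R.
Proof.
by move=> cr; rewrite val_ucl ?pexpe_gt1 ?coprimez_pexp // rmorphM.
Qed.

(** Cancelling the common factor [p] lowers the modulus by one power ([pXu_eq] with exponent 1). For
    [e = 1] both products are [0], and [U_(p^0)] is trivial. *)
Lemma pr_eq (r r' : int) : coprimez p r -> coprimez p r' ->
  ((p%:Z * r)%:~R == (p%:Z * r')%:~R :> R) =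
  (ucl (p ^ e.-1) r == ucl (p ^ e.-1) r').
Proof.
move=> cr cr'; rewrite !pr_ucl // -[p%:R]expr1 pXu_eq // eqxx subn1 /=.
by rewrite !ured_ucl ?leq_pred.
Qed.

Lemma cA1 (phi : cA p e) : phi 1%g = 1%g.
Proof. by apply: (mulgI (phi 1%g)); rewrite -cAM !mulg1. Qed.

Lemma psi_unit (r : int) (cr : coprimez p r) (phi : cA p e) (b : U e) :
  psi p_pr e_gt0 cr phi (val b) = val (phi b).
Proof.
by have := psiE p_pr e_gt0 cr phi b (leq0n e); rewrite !expr0 !mul1r.
Qed.

Lemma psi_p (r : int) (cr : coprimez p r) (phi : cA p e) :
  psi p_pr e_gt0 cr phi p%:R = (p%:Z * r)%:~R.
Proof.
have := psiE p_pr e_gt0 cr phi 1%g e_gt0.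
by rewrite !expr1 cA1 !mulr1.
Qed.

Lemma monautX n (g : monaut n) x k : g (x ^+ k) = g x ^+ k.
Proof.
by elim: k => [|k IH]; rewrite ?expr0 ?monaut1 // !exprS monautM IH.
Qed.

(** [p] and the units generate the monoid, since every element is some [p^u b]. *)
Lemma monaut_eq (g h : monaut (p ^ e)) :
  g p%:R = h p%:R -> (forall b : U e, g (val b) = h (val b)) -> g = h.
Proof.
move=> ghp ghU; apply/val_inj/permP => x.
have [[u b] /= /eqP ->] := pXu_decomp p_pr e_gt0 x.
by rewrite !monautM !monautX ghp ghU.
Qed.

Lemma psi_eq (r r' : int) (cr : coprimez p r) (cr' : coprimez p r')
    (phi phi' : cA p e) :
  psi p_pr e_gt0 cr phi = psi p_pr e_gt0 cr' phi' <->
  ucl (p ^ e.-1) r = ucl (p ^ e.-1) r' /\ phi = phi'.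
Proof.
split=> [E | [/eqP]].
  split; first by apply/eqP; rewrite -pr_eq // -(psi_p cr phi) E psi_p.
  apply/val_inj/permP => b; apply: val_inj.
  by rewrite -(psi_unit cr) E psi_unit.
rewrite -pr_eq // => /eqP E <-.
by apply: monaut_eq => [|b]; rewrite ?psi_p // !psi_unit.
Qed.

(** The twist by [phi] arises at [p]: the composite sends it to [psi(p r') = p r phi(r')]. As [phi]
    acts on classes only, [s] is any integer representing [r phi(r')]. *)
Lemma psi_mul (r r' s : int) (cr : coprimez p r) (cr' : coprimez p r')
    (cs : coprimez p s) (phi phi' : cA p e) :
  ucl (p ^ e) s = (ucl (p ^ e) r * phi (ucl (p ^ e) r'))%g ->
  (psi p_pr e_gt0 cr phi * psi p_pr e_gt0 cr' phi')%g =
  psi p_pr e_gt0 cs (phi * phi')%g.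
Proof.
move=> sE; apply: monaut_eq => [|b]; last by rewrite monautE !psi_unit cAE.
rewrite monautE !psi_p pr_ucl // monautM psi_p psi_unit !pr_ucl // sE.
by rewrite FinRing.val_unitM mulrA.
Qed.

Lemma monaut_is_unit (g : monaut (p ^ e)) (b : U e) :
  g (val b) \is a GRing.unit.
Proof.
apply/unitrP; exists (g (val b^-1%g)).
by rewrite -!monautM -!FinRing.val_unitM mulVg mulgV monaut1.
Qed.

Definition monaut_res (g : monaut (p ^ e)) (b : U e) : U e :=
  FinRing.unit _ (monaut_is_unit g b).

Lemma monaut_res_inj (g : monaut (p ^ e)) : injective (monaut_res g).
Proof. by move=> b c /(congr1 val) /perm_inj /val_inj. Qed.

Lemma monaut_res_Aut (g : monaut (p ^ e)) :
  perm (@monaut_res_inj g) \in Aut (units_Zp (p ^ e)).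
Proof.
rewrite inE; apply/andP; split; first by apply/subsetP => x; rewrite inE.
apply/morphicP => b c _ _; rewrite !permE; apply: val_inj.
by rewrite FinRing.val_unitM /= monautM.
Qed.

Lemma pX_eq0 w : (p%:R ^+ w == 0 :> R) = (e <= w)%N.
Proof.
rewrite -natrX (eq_natZ _ 0) ?pexpe_gt1 // mod0n -/(dvdn _ _).
by rewrite dvdn_Pexp2l ?prime_gt1.
Qed.

Lemma monaut_p (g : monaut (p ^ e)) : exists c : U e, g p%:R = p%:R * val c.
Proof.
(* Surjectivity gives [0 = g y] for some [y], so [g 0 = g (0 * y) = g 0 * 0]. *)
have g0 : g 0 = 0.
  by have := monautM g 0 (g^-1%g 0); rewrite mul0r -monautE mulgV perm1 mulr0.
have [[u c] /= /eqP gp] := pXu_decomp p_pr e_gt0 (g p%:R).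
(* [g] preserves and reflects vanishing, and the unit [c^w] does not affect it. *)
have gpX w : (p%:R ^+ (u * w) == 0 :> R) = (e <= w)%N.
  rewrite -[RHS]pX_eq0 -[RHS](inj_eq (@perm_inj _ g)) g0 monautX gp exprMn -exprM.
  by rewrite -FinRing.val_unitX mulIr_eq0 //; apply: mulIr; exact: (valP (c ^+ w)%g).
have gpe w : (e <= u * w)%N = (e <= w)%N by rewrite -pX_eq0 gpX.
have u_gt0 : (0 < u)%N.
  by rewrite lt0n; apply/eqP => u0; have := gpe e; rewrite u0 leqnn leqNgt e_gt0.
have u_le1 : (u <= 1)%N.
  have ue : (u <= e)%N by rewrite -ltnS.
  (* If [2 <= u <= e], then [e <= 2(e-1) <= u(e-1)], so [gpe] fails at [w = e-1]. *)
  have := gpe e.-1; rewrite [RHS]leqNgt ltn_predL e_gt0 /=.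
  apply: contraFT; rewrite -ltnNge => u_gt1; have e_gt1 := leq_trans u_gt1 ue.
  apply: leq_trans (leq_mul u_gt1 (leqnn _)).
  by rewrite mul2n -addnn -{1}(prednK e_gt0) -addn1 leq_add2l -ltnS prednK.
by exists c; rewrite gp (_ : (u : nat) = 1%N) //; apply/eqP; rewrite eqn_leq u_le1.
Qed.

Lemma psi_surj (g : monaut (p ^ e)) :
  exists (c : U e) (phi : cA p e), g = psi p_pr e_gt0 (coprimez_pu c) phi.
Proof.
have [c gp] := monaut_p g.
have gE u (b : U e) : g (p%:R ^+ u * val b) =
    p%:R ^+ u * val (c ^+ u * monaut_res g b)%g.
  rewrite monautM monautX gp exprMn -mulrA.
  by rewrite FinRing.val_unitM FinRing.val_unitX.
have resA : cA_axiom (perm (@monaut_res_inj g)).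
  apply: cA_axiomI (monaut_res_Aut g) _ => f x y fe; rewrite !permE.
  (* The exponent [e - f] makes equality of these products mean congruence of [x] and [y] modulo
     [p^f]. On the image side the common factor [c^(e-f)] cancels. *)
  have := inj_eq (@perm_inj _ g) (p%:R ^+ (e - f) * val x)
    (p%:R ^+ (e - f) * val y).
  rewrite !gE !pXu_eq ?leq_subr // eqxx /= subKn // !uredM //.
  by rewrite (inj_eq (mulgI _)).
exists c, (CA resA); apply: monaut_eq => [|b]; last by rewrite psi_unit permE.
by rewrite psi_p pr_ucl ?ucl_surj // (coprimez_pu c).
Qed.

(** The inverse of [Psi]. Here [ured] lifts the class modulo [p^(e-1)] up to [U_(p^e)]; by [psi_eq]
    the choice of lift is immaterial. *)
Definition psi_of (x : sdUA p e) : monaut (p ^ e) :=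
  psi p_pr e_gt0 (coprimez_pu (ured (p ^ e) x.1)) x.2.

Lemma psi_ofE (r : int) (cr : coprimez p r) (phi : cA p e) :
  psi_of (ucl (p ^ e.-1) r, phi) = psi p_pr e_gt0 cr phi.
Proof.
apply/psi_eq; split=> //=.
by rewrite -[RHS](uredK (leq_pred e)).
Qed.

Lemma psi_of_inj : injective psi_of.
Proof.
move=> [a phi] [b phi'] /psi_eq[/= ab <-]; congr (_, _).
by rewrite -(uredK (leq_pred e) a) -(uredK (leq_pred e) b).
Qed.

Lemma psi_of_surj (g : monaut (p ^ e)) : exists x, psi_of x == g.
Proof.
have [c [phi ->]] := psi_surj g.
by exists (ucl (p ^ e.-1) (nat_of_ord (val c))%:Z, phi); apply/eqP/psi_ofE.
Qed.

Lemma psi_ofM : {morph psi_of : x y / (x * y)%g}.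
Proof.
move=> x y; set a := ured (p ^ e) x.1; set b := ured (p ^ e) y.1.
rewrite [RHS](psi_mul _ _ (s := nat_of_ord (val (a * x.2 b)%g)) (coprimez_pu _));
  last by rewrite !ucl_surj.
(* The lift of the product may differ from [a * x.2 b], but both reduce to the same class modulo
   [p^(e-1)]. *)
apply/psi_eq; split=> //; rewrite -[LHS]/(ured (p ^ e.-1) (ured (p ^ e) _)).
rewrite uredK ?leq_pred // -[RHS]/(ured (p ^ e.-1) (a * x.2 b)%g).
by rewrite uredM ?leq_pred // uredK ?leq_pred.
Qed.

(** The chosen preimage is the only one, by [psi_of_inj]. *)
Definition Psi_fun (g : monaut (p ^ e)) : sdUA p e := xchoose (psi_of_surj g).

Lemma Psi_funK : cancel Psi_fun psi_of.
Proof. by move=> g; apply/eqP/(xchooseP (psi_of_surj g)). Qed.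

Lemma psi_ofK : cancel psi_of Psi_fun.
Proof. exact: inj_can_sym Psi_funK psi_of_inj. Qed.

Lemma Psi_funM : {in [set: monaut (p ^ e)] &, {morph Psi_fun : g h / (g * h)%g}}.
Proof. by move=> g h _ _; apply: psi_of_inj; rewrite psi_ofM !Psi_funK. Qed.

End AutomorphismsOfZpe.

Theorem theorem3p5 (p e : nat) (p_pr : prime p) (e_gt0 : (0 < e)%N) :
  exists Psi : {morphism [set: monaut (p ^ e)] >-> sdUA p e},
    (forall (r : int) (r_cop : coprimez p r) (phi : cA p e),
       Psi (psi p_pr e_gt0 r_cop phi) = (ucl (p ^ e.-1) r, phi)) /\
    isom [set: monaut (p ^ e)] [set: sdUA p e] Psi.
Proof.
exists (Morphism (@Psi_funM p e p_pr e_gt0)); split=> [r cr phi | ].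
  by rewrite /= -psi_ofE psi_ofK.
apply/isomP; split.
  by apply/injmP => g h _ _ /(can_inj (@Psi_funK _ _ p_pr e_gt0)).
apply/setP => x; rewrite inE; apply/morphimP.
by exists (psi_of p_pr e_gt0 x); rewrite ?inE //= psi_ofK.
Qed.
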